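(* Let $k$ and $i$ be integers with $1\le i\le k/2$ and $k\equiv 2\pmod 3$. Then for all integers $n\ge 0$: (1) if $i\equiv 2\pmod 9$, then $S_{k,i}(9n+5)\equiv S_{k,i}(9n+8)\equiv 0\pmod 4$; (2) if $i\equiv 5\pmod 9$, then $S_{k,i}(9n+2)\equiv S_{k,i}(9n+8)\equiv 0\pmod 4$; (3) if $i\equiv 8\pmod 9$, then $S_{k,i}(9n+2)\equiv S_{k,i}(9n+5)\equiv 0\pmod 4$.
   Context: Write $(a;q)_\infty=\prod_{m\ge 0}(1-aq^m)$, $(a)_\infty=(a;q)_\infty$, and $(a_1,\ldots,a_r;q)_\infty=(a_1;q)_\infty\cdots(a_r;q)_\infty$. For integers $k,i$ with $1\le i\le k/2$, the integers $S_{k,i}(n)$, $n\ge 0$, are given by the generating function $$\sum_{n\ge 0}S_{k,i}(n)q^n=\frac{(-q)_\infty\,(q^i,q^{k-i},q^k;q^k)_\infty}{(q)_\infty}.$$ Combinatorially (an overpartition of $n$ is a partition of $n$ in which the first occurrence of each integer may be overlined): if $i<k/2$, $S_{k,i}(n)$ is the number of overpartitions of $n$ whose non-overlined parts are not congruent to $0,\pm i$ modulo $k$; if $i=k/2$, it is the number of overpartitions of $n$ with no part divisible by $k/2$. *)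

(* Defs.v *)
From mathcomp Require Import all_boot all_order all_algebra.
Set Implicit Arguments.
Unset Strict Implicit.
Unset Printing Implicit Defensive.
Import Order.TTheory GRing.Theory Num.Theory.
Local Open Scope ring_scope.

(* Formal power series in q over the integers, as coefficient sequences. *)
Definition fps := nat -> int.

Definition fps_one : fps := fun n => (n == 0%N)%:R.

Definition fps_mul (f g : fps) : fps :=
  fun n => \sum_(j < n.+1) f j * g (n - j)%N.

(* The first n coefficients of 1 / f, highest degree first, for f 0 = 1; they
   are determined by g n = [n = 0] - \sum_(0 < j <= n) f j * g (n - j). *)
Fixpoint fps_inv_rev (f : fps) (n : nat) : seq int :=
  if n is m.+1 then
    let s := fps_inv_rev f m in
    ((m == 0%N)%:R - \sum_(j < m) f j.+1 * s`_j) :: s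
  else [::].

Definition fps_inv (f : fps) : fps := fun n => (fps_inv_rev f n.+1)`_0.

Lemma nth_fps_inv_rev (f : fps) (n j : nat) :
  (j < n)%N -> (fps_inv_rev f n)`_j = fps_inv f (n.-1 - j)%N.
Proof.
elim: n j => [//|n IHn] [|j] ltjn; first by rewrite subn0.
rewrite [LHS]/= IHn //=; congr (fps_inv f _).
by case: n ltjn {IHn} => // n _; rewrite subSS.
Qed.

Lemma fps_mulV (f : fps) : f 0%N = 1 -> fps_mul f (fps_inv f) =1 fps_one.
Proof.
move=> f0 n; rewrite /fps_mul big_ord_recl f0 mul1r subn0 {1}/fps_inv /=.
rewrite -addrA -[RHS]addr0; congr (_ + _).
apply/eqP; rewrite addrC subr_eq0; apply/eqP/eq_bigr => j _.
rewrite nth_fps_inv_rev // /bump leq0n add1n.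
by congr (_ * fps_inv f _); case: n j => [[]|n j] //=; rewrite subSS.
Qed.

Definition qpoch_part (a b : {poly int}) (N : nat) : {poly int} :=
  \prod_(m < N) (1 - a * b ^+ m).

(* The power series (a; b)_oo, for polynomials a and b in q with b(0) = 0: its
   n-th coefficient is that of any partial product with more than n factors
   (see qpochE). The variable q is 'X. *)
Definition qpoch (a b : {poly int}) : fps := fun n => (qpoch_part a b n.+1)`_n.

Lemma qpochE (a b : {poly int}) (n N : nat) :
  b`_0 = 0 -> (n < N)%N -> (qpoch_part a b N)`_n = qpoch a b n.
Proof.
move=> b0; have [c ->] : exists c, b = c * 'X.
  exists (drop_poly 1 b); rewrite -[LHS](poly_take_drop 1) expr1.
  suff -> : take_poly 1 b = 0 by rewrite add0r.
  by apply/polyP=> -[|j]; rewrite coef_take_poly ?b0 !coef0.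
elim: N => // N IHN; rewrite ltnS leq_eqVlt => /predU1P[->//|ltnN].
rewrite -IHN // /qpoch_part big_ord_recr /= exprMn mulrBr mulr1 !mulrA.
by rewrite coefB coefMXn ltnN subr0.
Qed.

(* (a_1, ..., a_r; b)_oo *)
Definition qpochs (s : seq {poly int}) (b : {poly int}) : fps :=
  \big[fps_mul/fps_one]_(a <- s) qpoch a b.

(* The sequence n |-> S_{k,i}(n), meaningful for 1 <= i <= k / 2. *)
Definition S_ (k i : nat) : fps :=
  fps_mul
    (fps_mul (qpoch (- 'X) 'X) (qpochs [:: 'X^i; 'X^(k - i); 'X^k] 'X^k))
    (fps_inv (qpoch 'X 'X)).

(* Main.v *)
(* With [Q = (q)_oo], [P = (-q)_oo] and [T] the Jacobi theta series of
   (q^i, q^(k-i), q^k; q^k)_oo, the generating function [S] satisfies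
   [S Q = P T].  Gauss's identity [Q = P phi], with [phi = \sum_j (-1)^j q^(j^2)], gives
   [S Q^2 = P^2 T phi]; since [P = Q] mod 2, also [P^2 = Q^2] mod 4, so
   [S = T phi] mod 4.  An exponent of [T phi] has the form
   k j(j-1)/2 + i j + r^2, and under the hypotheses on [k] and [i] it can be
   2 mod 3 only if it is [i] mod 9.
   Every series is truncated modulo ['X^N]; the theta series come from the
   finite form of the triple product, which follows from q-Pascal. *)
Require Import Defs.
From mathcomp Require Import all_boot all_order all_algebra.
From mathcomp Require Import zify ring.
Set Implicit Arguments.
Unset Strict Implicit.
Unset Printing Implicit Defensive.
Import Order.TTheory GRing.Theory Num.Theory.
Local Open Scope ring_scope.

(** * Gaussian binomials and the finite triple product *)

Section FiniteTripleProduct.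

Variable R : comNzRingType.
Implicit Types (a b q : R) (n t M N : nat).

(** Gaussian binomial by q-Pascal, since [R] has no division; where [n' - t'] truncates, the factor
    [qbinom q n' t'] is zero. *)
Fixpoint qbinom q n t : R :=
  match n, t with
  | _, 0 => 1
  | 0, _.+1 => 0
  | n'.+1, t'.+1 => qbinom q n' t'.+1 + q ^+ (n' - t') * qbinom q n' t'
  end.

Lemma qbinom0 q n : qbinom q n 0 = 1.
Proof. by case: n. Qed.

Lemma qbinom_small q n t : (n < t)%N -> qbinom q n t = 0.
Proof.
elim: n t => [|n IHn] [|t] //= ltnt.
by rewrite !IHn ?mulr0 ?addr0 // ltnW.
Qed.

(* Truncated subtraction is harmless: for [t > n] both sides vanish. *)
Lemma qbinom_qfact q n t :
  qbinom q n t * \prod_(l < t) (1 - q ^+ l.+1)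
  = \prod_(l < t) (1 - q ^+ (n - l)).
Proof.
elim: n t => [|n IHn] [|t]; rewrite ?qbinom0 ?big_ord0 ?mul1r //.
  by rewrite /= mul0r big_ord_recl /= subrr mul0r.
have [letn|ltnt] := leqP t n; last first.
  rewrite qbinom_small // mul0r (bigD1 (@Ordinal t.+1 n.+1 ltnt)) //=.
  by rewrite subnn subrr mul0r.
rewrite /= mulrDl IHn big_ord_recr /=.
rewrite [X in _ + X](_ : _ = q ^+ (n - t) * (1 - q ^+ t.+1) *
   (qbinom q n t * \prod_(l < t) (1 - q ^+ l.+1))); last first.
  by rewrite big_ord_recr /=; ring.
rewrite IHn big_ord_recl subn0 /=.
under [in RHS]eq_bigr do rewrite /bump leq0n add1n subSS.
(* The q-Pascal terms combine by [(1 - q^(n-t)) + q^(n-t) (1 - q^(t+1)) = 1 - q^(n+1)]. *)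
have -> : q ^+ n.+1 = q ^+ (n - t) * q ^+ t.+1.
  by rewrite -exprD; congr (_ ^+ _); lia.
ring.
Qed.

Lemma prod_1subX_mod (I : Type) (r : seq I) (P : pred I) (e : I -> nat) q m :
  (forall l, P l -> (m <= e l)%N) ->
  exists u, \prod_(l <- r | P l) (1 - q ^+ e l) = 1 + u * q ^+ m.
Proof.
move=> le_me; elim/big_rec: _ => [|l _ Pl [u ->]].
  by exists 0; rewrite mul0r addr0.
exists (u - q ^+ (e l - m) * (1 + u * q ^+ m)).
by rewrite -{1}(subnK (le_me _ Pl)) exprD; ring.
Qed.

(** Splitting [(q)_n] at [t] cancels the denominator of the binomial; the surviving exponents are at
    least [n - t + 1] or [t + 1]. This removes the binomials from the triple product in the
    limit. *)
Lemma qbinom_qfact_mod q n t : (t <= n)%N ->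
  exists u, qbinom q n t * \prod_(l < n) (1 - q ^+ l.+1)
            = 1 + u * q ^+ (minn t (n - t)).+1.
Proof.
move=> letn; set m := (minn t (n - t)).+1.
rewrite -(big_mkord xpredT (fun l => 1 - q ^+ l.+1)).
rewrite (big_cat_nat (n := t)) //= mulrA big_mkord qbinom_qfact.
have [l|u ->] := @prod_1subX_mod _ (index_enum 'I_t) xpredT
  (fun l => n - l)%N q m.
  by move=> _; have := ltn_ord l; rewrite /m; lia.
rewrite big_nat_cond.
have [l|v ->] := @prod_1subX_mod _ (index_iota t n)
  (fun l => (t <= l < n)%N && true) (fun l => l.+1) q m.
  by rewrite /m; lia.
by exists (u + v + u * v * q ^+ m); ring.
Qed.

(* The [j]-th term of Ramanujan's theta function [f(-a, -b)], for the
   integer [j = t - N], is [(-1)^j a^(j(j+1)/2) b^(j(j-1)/2)]; in each exponent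
   at most one of the two binomials is nonzero. *)
Definition theta_term a b N t : R :=
  (-1) ^+ (N + t) * a ^+ ('C((t - N).+1, 2) + 'C(N - t, 2))
                  * b ^+ ('C(t - N, 2) + 'C((N - t).+1, 2)).

(** With [j = t - N], consecutive terms have ratio [- a (a b)^j]; the factor [(a b)^(M - j)] keeps
    exponents natural when [j < 0]. *)
Lemma theta_termS a b M N t : (t <= M + N)%N ->
  theta_term a b N t * (- (a * (a * b) ^+ M))
  = theta_term a b N t.+1 * (a * b) ^+ (M + N - t).
Proof.
move=> letMN; rewrite /theta_term !exprMn addnS exprS.
set e1 := (_ + 'C(N - t, 2))%N; set f1 := ('C(t - N, 2) + _)%N.
set e2 := (_ + 'C(N - t.+1, 2))%N; set f2 := ('C(t.+1 - N, 2) + _)%N.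
have E : (e1 + M.+1 = e2 + (M + N - t))%N /\ (f1 + M = f2 + (M + N - t))%N.
  rewrite /e1 /e2 /f1 /f2; have [leNt|ltNt] := leqP N t.
    have [s Es] : exists s, t = (N + s)%N by exists (t - N)%N; lia.
    rewrite {}Es in letMN *.
    have -> : (N + s - N = s)%N by lia.
    have -> : ((N + s).+1 - N = s.+1)%N by lia.
    have -> : (N - (N + s) = 0)%N by lia.
    have -> : (N - (N + s).+1 = 0)%N by lia.
    rewrite !binS !bin1 ?bin0 !bin0n /=; lia.
  have [s ->] : exists s, N = (t + s).+1 by exists (N - t.+1)%N; lia.
  have -> : (t - (t + s).+1 = 0)%N by lia.
  have -> : (t.+1 - (t + s).+1 = 0)%N by lia.
  have -> : ((t + s).+1 - t = s.+1)%N by lia.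
  have -> : ((t + s).+1 - t.+1 = s)%N by lia.
  rewrite !binS !bin1 ?bin0 !bin0n /=; lia.
have [Ea Eb] := E.
transitivity (- (-1) ^+ (N + t) * (a ^+ (e1 + M.+1)) * (b ^+ (f1 + M))).
  by rewrite !exprD exprS; ring.
by rewrite Ea Eb !exprD; ring.
Qed.

(** Induction peels off [1 - x] and replaces [x] by [x q]. Powers count down as [N - t] to match
    [theta_term]. *)
Lemma qbinom_theorem q x N :
  \prod_(m < N) (1 - x * q ^+ m) =
  \sum_(t < N.+1)
     (-1) ^+ (N - t) * q ^+ 'C(N - t, 2) * x ^+ (N - t) * qbinom q N t.
Proof.
elim: N x => [|N IHN] x; first by rewrite big_ord0 big_ord1 /= !mulr1.
rewrite big_ord_recl mulr1.
under eq_bigr do rewrite lift0 exprS mulrA.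
rewrite {}IHN; set F := fun t => (-1) ^+ (N - t) * q ^+ 'C(N - t, 2)
  * (x * q) ^+ (N - t) * qbinom q N t.
have EF : \sum_(t < N.+1) F t = \sum_(t < N.+2) F t.
  by rewrite [RHS]big_ord_recr /= [F N.+1]/F qbinom_small // mulr0 addr0.
rewrite mulrBl mul1r [in X in _ - X]EF.
rewrite [in X in _ - X]big_ord_recl mulrDr opprD addrCA [RHS]big_ord_recl.
congr (_ + _).
  rewrite /F !subn0 !qbinom0 binS bin1 exprD exprMn !exprS; ring.
rewrite mulr_sumr -sumrB; apply: eq_bigr => -[t /= ltt] _.
rewrite /F /bump leq0n add1n subSS; have [->|ltN] := eqVneq t N.
  by rewrite (qbinom_small _ (ltnSn N)) subnn /=; ring.
have -> : (N - t = (N - t.+1).+1)%N by lia.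
by rewrite !add0n binS bin1 !exprD !exprMn !exprS; ring.
Qed.

(** For [M = 0] this is the q-binomial theorem at [x = b]. By [theta_termS], multiplying by
    [1 - a (a b)^M] reproduces q-Pascal. *)
Lemma finite_triple_product a b M N :
  (\prod_(m < M) (1 - a * (a * b) ^+ m))
    * (\prod_(m < N) (1 - b * (a * b) ^+ m))
  = \sum_(t < (M + N).+1) theta_term a b N t * qbinom (a * b) (M + N) t.
Proof.
elim: M => [|M IHM].
  rewrite big_ord0 mul1r qbinom_theorem; apply: eq_bigr => -[t /= ltt] _.
  rewrite /theta_term.
  have -> : (t - N = 0)%N by lia.
  rewrite -signr_odd oddB // -oddD signr_odd.
  by rewrite exprMn !binS !bin1 (@bin_small 0) // !add0n !exprD; ring.
rewrite big_ord_recr [LHS]/= mulrAC IHM mulr_suml.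
set c := theta_term a b N; set q := a * b; set n := (M + N)%N.
transitivity (\sum_(t < n.+1) c t * qbinom q n t
   + \sum_(t < n.+1) c t.+1 * (q ^+ (n - t) * qbinom q n t)).
  rewrite -big_split; apply: eq_bigr => -[t /= ltt] _.
  rewrite [X in _ = _ + X]mulrA -theta_termS // -/q -/(c t) /=.
  by rewrite mulrBr mulr1 mulrN mulNr [_ * (a * _) * _]mulrAC.
have -> : \sum_(t < n.+1) c t * qbinom q n t
        = \sum_(t < n.+2) c t * qbinom q n t.
  by rewrite [RHS]big_ord_recr /= qbinom_small // mulr0 addr0.
rewrite big_ord_recl -addrA -big_split [RHS]big_ord_recl /= qbinom0.
congr (_ + _); apply: eq_bigr => -[t /= ltt] _.
by rewrite /bump leq0n add1n mulrDr.
Qed.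

End FiniteTripleProduct.

(** * Congruences between truncated power series *)

Section PowerSeriesCongruence.

Variables (d : int) (N : nat).
Implicit Types p r u : {poly int}.

(* Congruence modulo the ideal generated by [d] and ['X^N]. *)
Definition eqmodX p r := forall m, (m < N)%N -> (d %| (p - r)`_m)%Z.

Lemma eqmodX_refl p : eqmodX p p.
Proof. by move=> m _; rewrite subrr coef0 dvdz0. Qed.

Lemma eqmodX_coef p r : (forall m, (m < N)%N -> p`_m = r`_m) -> eqmodX p r.
Proof. by move=> e m ltm; rewrite coefB e // subrr dvdz0. Qed.

Lemma eqmodX_sym p r : eqmodX p r -> eqmodX r p.
Proof. by move=> e m ltm; rewrite -opprB coefN rpredN e. Qed.

Lemma eqmodX_trans r p u : eqmodX p r -> eqmodX r u -> eqmodX p u.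
Proof.
move=> e1 e2 m ltm; have -> : p - u = (p - r) + (r - u) by ring.
by rewrite coefD rpredD ?e1 ?e2.
Qed.

Lemma eqmodXD p r p' r' :
  eqmodX p r -> eqmodX p' r' -> eqmodX (p + p') (r + r').
Proof.
move=> e1 e2 m ltm; have -> : p + p' - (r + r') = (p - r) + (p' - r') by ring.
by rewrite coefD rpredD ?e1 ?e2.
Qed.

Lemma eqmodX_sum (I : Type) (s : seq I) (P : pred I) (f g : I -> {poly int}) :
  (forall j, P j -> eqmodX (f j) (g j)) ->
  eqmodX (\sum_(j <- s | P j) f j) (\sum_(j <- s | P j) g j).
Proof.
move=> e; elim/big_rec2: _ => [|j p r Pj IH]; first exact: eqmodX_refl.
by apply: eqmodXD => //; apply: e.
Qed.

Lemma eqmodXMl u p r : eqmodX p r -> eqmodX (u * p) (u * r).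
Proof.
move=> e m ltm; rewrite -mulrBr coefM rpred_sum // => j _.
by rewrite dvdz_mull // e // (leq_ltn_trans (leq_subr _ _)).
Qed.

Lemma eqmodXMr u p r : eqmodX p r -> eqmodX (p * u) (r * u).
Proof. by rewrite ![_ * u]mulrC; apply: eqmodXMl. Qed.

Lemma eqmodXM p r p' r' :
  eqmodX p r -> eqmodX p' r' -> eqmodX (p * p') (r * r').
Proof.
by move=> e e'; apply: eqmodX_trans (eqmodXMl r e'); apply: eqmodXMr.
Qed.

Lemma eqmodX_addMXn p u e : (N <= e)%N -> eqmodX (p + u * 'X^e) p.
Proof.
move=> leNe m ltm; have -> : p + u * 'X^e - p = u * 'X^e by ring.
by rewrite coefMXn (leq_trans ltm) // dvdz0.
Qed.

(** Strong induction: the [m]-th coefficient of [(p - r) * u] is that of [p - r] plus multiples of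
    earlier ones. *)
Lemma eqmodX_mulIr u p r : u`_0 = 1 -> eqmodX (p * u) (r * u) -> eqmodX p r.
Proof.
move=> u0 e; elim/ltn_ind => m IHm ltm.
have := e m ltm; rewrite -mulrBl coefM big_ord_recr /= subnn u0 mulr1.
rewrite rpredDl // rpred_sum // => j _; rewrite dvdz_mulr // IHm //.
exact: ltn_trans ltm.
Qed.

Lemma qpoch_part_eqmodX (a b : {poly int}) M M' :
  b`_0 = 0 -> (N <= M)%N -> (N <= M')%N ->
  eqmodX (qpoch_part a b M) (qpoch_part a b M').
Proof.
move=> b0 leM leM'; apply: eqmodX_coef => m ltm.
by rewrite !qpochE // (leq_trans ltm).
Qed.

End PowerSeriesCongruence.

Lemma fps_mul_coef N (f g : fps) (p r : {poly int}) :
  (forall m, (m < N)%N -> f m = p`_m) -> (forall m, (m < N)%N -> g m = r`_m) ->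
  forall m, (m < N)%N -> fps_mul f g m = (p * r)`_m.
Proof.
move=> fp gr m ltm; rewrite coefM /fps_mul; apply: eq_bigr => j _.
by rewrite fp ?gr // (leq_trans _ ltm) // ltnS leq_subr.
Qed.

(** * Jacobi's triple product and Gauss's identity, truncated *)

(** For [i <= k] and [j = t - N] this is [k j(j-1)/2 + i j], written without negative numbers. *)
Definition theta_exp (i k N t : nat) : nat :=
  i * ('C((t - N).+1, 2) + 'C(N - t, 2))
  + (k - i) * ('C(t - N, 2) + 'C((N - t).+1, 2)).

Definition theta_sum (i k N : nat) : {poly int} :=
  \sum_(t < (N + N).+1) ((-1) ^+ (N + t))%:P * 'X^(theta_exp i k N t).

Lemma jacobi_triple_product d i k N : (0 < i < k)%N ->
  eqmodX d N (qpoch_part 'X^i 'X^k N * qpoch_part 'X^(k - i) 'X^k N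
              * qpoch_part 'X^k 'X^k N)
         (theta_sum i k N).
Proof.
move=> /andP[i0 ltik].
have Xk : 'X^i * 'X^(k - i) = 'X^k :> {poly int}.
  by rewrite -exprD subnKC // ltnW.
(* The third product gets [N + N] factors, to clear the binomials [qbinom _ (N + N) t]. *)
apply: (@eqmodX_trans _ _ (qpoch_part 'X^i 'X^k N
   * qpoch_part 'X^(k - i) 'X^k N * qpoch_part 'X^k 'X^k (N + N))).
  apply/eqmodXMl/qpoch_part_eqmodX; rewrite ?leq_addr // coefXn.
  by case: k ltik {Xk}.
rewrite /theta_sum /qpoch_part -Xk finite_triple_product mulr_suml Xk.
apply: eqmodX_sum => -[t /= ltt] _.
have -> : theta_term 'X^i 'X^(k - i) N t
    = ((-1) ^+ (N + t))%:P * 'X^(theta_exp i k N t) :> {poly int}.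
  by rewrite /theta_term -!exprM -mulrA -exprD rmorphXn /= rmorphN1.
set C := \prod_(m < _) _.
have -> : C = \prod_(l < N + N) (1 - ('X^k) ^+ l.+1).
  by apply: eq_bigr => l _; rewrite exprS.
rewrite -!mulrA; apply: eqmodXMl.
have [//|u ->] := @qbinom_qfact_mod _ ('X^k : {poly int}) (N + N) t.
rewrite mulrDr mulr1 mulrCA -exprM -exprD; apply: eqmodX_addMXn.
(* With [j = t - N], the minimum is [N - |j|] and the theta exponent is at least [|j|], so the error
   has order at least [N]. *)
rewrite /theta_exp; have [leNt|ltNt] := leqP N t.
  have : (i * (t - N) <= i * 'C((t - N).+1, 2))%N.
    by rewrite leq_mul2l binS bin1 leq_addl orbT.
  nia.
have : ((k - i) * (N - t) <= (k - i) * 'C((N - t).+1, 2))%N.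
  by rewrite leq_mul2l binS bin1 leq_addl orbT.
nia.
Qed.

Lemma qpoch_part_double M :
  qpoch_part 'X 'X (M + M) = qpoch_part 'X^1 'X^2 M * qpoch_part 'X^2 'X^2 M.
Proof.
elim: M => [|M IHM]; first by rewrite /qpoch_part !big_ord0 mulr1.
rewrite addSn addnS /qpoch_part !big_ord_recr /= -!/(qpoch_part _ _ _).
rewrite {}IHM -!exprM mul2n -addnn !exprS expr0; ring.
Qed.

Lemma qpoch_partNXX M :
  qpoch_part (- 'X) 'X M * qpoch_part 'X 'X M = qpoch_part 'X^2 'X^2 M.
Proof.
rewrite /qpoch_part -big_split; apply: eq_bigr => m _ /=.
by rewrite -exprM mulnC exprM; ring.
Qed.

Lemma coef0_qpoch_part (a b : {poly int}) M :
  a`_0 = 0 -> (qpoch_part a b M)`_0 = 1.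
Proof.
move=> a0; rewrite /qpoch_part coef0_prod big1 // => m _.
by rewrite coefB coef1 coef0M a0 mul0r subr0.
Qed.

(* Gauss's identity: [theta_sum 1 2 N] truncates [\sum_j (-1)^j q^(j^2)]. *)
Lemma gauss_theta d N :
  eqmodX d N (qpoch_part 'X 'X N) (qpoch_part (- 'X) 'X N * theta_sum 1 2 N).
Proof.
set P := qpoch_part (- 'X) 'X N; set Q := qpoch_part 'X 'X N.
set A := qpoch_part 'X^1 'X^2 N; set C := qpoch_part 'X^2 'X^2 N.
have QE : eqmodX d N Q (A * C).
  rewrite -qpoch_part_double.
  by apply: qpoch_part_eqmodX; rewrite ?coefX ?leq_addr.
(* Euler's [(-q)_oo (q; q^2)_oo = 1]: after multiplication by [C], both sides are
   [(q^2; q^2)_oo]. *)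
have PA : eqmodX d N (P * A) 1.
  apply: (@eqmodX_mulIr _ _ C); first by rewrite coef0_qpoch_part // coefXn.
  rewrite mul1r -mulrA -[X in eqmodX _ _ _ X]qpoch_partNXX.
  exact/eqmodXMl/eqmodX_sym.
(* Inserting [P A = 1] gives [A A C], the triple product for [i = 1], [k = 2]. *)
apply: eqmodX_trans QE _; apply: (@eqmodX_trans _ _ (P * (A * A * C))).
  have -> : P * (A * A * C) = P * A * (A * C) by ring.
  by rewrite -[X in eqmodX _ _ X]mul1r; apply/eqmodXMr/eqmodX_sym.
by apply/eqmodXMl/jacobi_triple_product.
Qed.

(** * The generating function modulo 4 *)

Lemma S_eqmodX d k i N : (1 <= i)%N -> (2 * i <= k)%N ->
  eqmodX d N ((\poly_(m < N) S_ k i m) * qpoch_part 'X 'X N)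
             (qpoch_part (- 'X) 'X N * theta_sum i k N).
Proof.
move=> i0 leik; have Xk0 : ('X^k : {poly int})`_0 = 0.
  by rewrite coefXn; case: k leik; lia.
set P := qpoch_part (- 'X) 'X N; set Q := qpoch_part 'X 'X N.
pose V := \poly_(m < N) fps_inv (qpoch 'X 'X) m.
pose A := qpoch_part 'X^i 'X^k N; pose B := qpoch_part 'X^(k - i) 'X^k N.
pose C := qpoch_part 'X^k 'X^k N.
have VE m : (m < N)%N -> fps_inv (qpoch 'X 'X) m = V`_m.
  by move=> ltm; rewrite coef_poly ltm.
have QE m : (m < N)%N -> qpoch 'X 'X m = Q`_m.
  by move=> ltm; rewrite /Q qpochE // coefX.
have VQ : eqmodX d N (V * Q) 1.
  apply: eqmodX_coef => m ltm.
  rewrite mulrC -(fps_mul_coef QE VE) // fps_mulV ?coef1 //.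
  by rewrite /qpoch coef0_qpoch_part // coefX.
(* The final [1] mirrors the empty product that ends [qpochs]. *)
have SE : eqmodX d N (\poly_(m < N) S_ k i m) (P * (A * (B * (C * 1))) * V).
  apply: eqmodX_coef => m ltm; rewrite coef_poly ltm.
  apply: (fps_mul_coef _ VE) => // {ltm}m; apply: fps_mul_coef => {}m ltm.
    by rewrite /P qpochE // coefX.
  rewrite /qpochs !big_cons big_nil; move: m ltm.
  do 3! [apply: fps_mul_coef => [m ltm|]; first by rewrite qpochE].
  by move=> m _; rewrite coef1.
apply: eqmodX_trans (eqmodXMr Q SE) _; rewrite -[_ * V * Q]mulrA.
apply: eqmodX_trans (eqmodXMl _ VQ) _; rewrite !mulr1.
by apply: eqmodXMl; rewrite mulrA; apply: jacobi_triple_product; lia.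
Qed.

(** Signs vanish modulo 2, so [P = Q + 2 r] and [P^2 = Q^2 + 4 (r Q + r^2)]. *)
Lemma qpoch_part_sqr_mod4 N :
  eqmodX 4 N (qpoch_part (- 'X) 'X N ^+ 2) (qpoch_part 'X 'X N ^+ 2).
Proof.
have [r ->] : exists r, qpoch_part (- 'X) 'X N = qpoch_part 'X 'X N + r *+ 2.
  rewrite /qpoch_part; elim/big_rec2: _ => [|m p _ _ [u ->]].
    by exists 0; rewrite mul0rn addr0.
  by exists ((1 - 'X * 'X ^+ m) * u + 'X * 'X ^+ m * (p + u *+ 2)); ring.
set Q := qpoch_part _ _ _ => m _.
have -> : (Q + r *+ 2) ^+ 2 - Q ^+ 2 = (r * Q + r ^+ 2) *+ 4 by ring.
by rewrite coefMn -[X in (_ %| X)%Z]mulr_natr dvdz_mull.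
Qed.

Lemma S_mod4 k i N : (1 <= i)%N -> (2 * i <= k)%N ->
  eqmodX 4 N (\poly_(m < N) S_ k i m) (theta_sum i k N * theta_sum 1 2 N).
Proof.
move=> i0 leik; set S := \poly_(m < N) _.
set T := theta_sum i k N; set phi := theta_sum 1 2 N.
pose P := qpoch_part (- 'X) 'X N; pose Q := qpoch_part 'X 'X N.
apply: (@eqmodX_mulIr _ _ (Q ^+ 2)).
  by rewrite coef0M coef0_qpoch_part ?mulr1 // coefX.
apply: (@eqmodX_trans _ _ (P * T * (P * phi))).
  rewrite expr2 [S * _]mulrA; apply: eqmodXM; last exact: gauss_theta.
  exact: S_eqmodX.
have -> : P * T * (P * phi) = T * phi * P ^+ 2 by ring.
exact/eqmodXMl/qpoch_part_sqr_mod4.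
Qed.

(** * Exponents of the theta product modulo 3 and 9 *)

Lemma coef_theta_sumM i k i' k' N n :
  (forall t s, theta_exp i k N t + theta_exp i' k' N s != n)%N ->
  (theta_sum i k N * theta_sum i' k' N)`_n = 0.
Proof.
move=> neq; rewrite /theta_sum big_distrlr coef_sum big1 // => t _.
rewrite coef_sum big1 // => s _.
rewrite /= mulrACA -polyCM -['X^_ * _]exprD coefCM coefXn eq_sym.
by rewrite (negPf (neq t s)) mulr0.
Qed.

(* 5 inverts 2 modulo 9, and s - 1 is replaced by s + 8. *)
Lemma bin2_mod9 s : 'C(s, 2) = 5 * s * (s + 8) %[mod 9].
Proof.
elim: s => // s IHs; rewrite binS bin1 -modnDml IHs modnDml.
have -> : (5 * s.+1 * (s.+1 + 8)
            = (s + 5) * 9 + (5 * s * (s + 8) + s))%N by lia.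
by rewrite modnMDl.
Qed.

Lemma congrD m a a' b b' :
  a = a' %[mod m] -> b = b' %[mod m] -> a + b = a' + b' %[mod m].
Proof. by move=> ea eb; rewrite -modnDm ea eb modnDm. Qed.

Lemma congrM m a a' b b' :
  a = a' %[mod m] -> b = b' %[mod m] -> a * b = a' * b' %[mod m].
Proof. by move=> ea eb; rewrite -modnMm ea eb modnMm. Qed.

(** Here [d] stands for [k - i] and [c] for the sign of [j]. Being 2 mod 3 forces [r] to be 0 and
    the binomial beside [i] to be 1 mod 3; that binomial is then 1 mod 9 and the other is divisible
    by 3. The proof checks all residues. *)
Lemma theta_form_mod9 (c : bool) i d s r :
  i = 2 %[mod 3] -> d = 0 %[mod 3] ->
  let E := (i * 'C(s + c, 2) + d * 'C(s + ~~ c, 2) + r ^ 2)%N in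
  E = 2 %[mod 3] -> E = i %[mod 9].
Proof.
move=> i3 d3 E.
(* Unlike ['C(n, 2)], this polynomial form visibly depends only on [n] modulo 9. *)
pose bin2' n := (5 * n * (n + 8))%N.
pose form i d s r := (i * bin2' (s + c) + d * bin2' (s + ~~ c) + r * r)%N.
have EE : E = form (i %% 9)%N (d %% 9)%N (s %% 9)%N (r %% 9)%N %[mod 9].
  rewrite /E /form /bin2' -mulnn.
  apply: congrD; [apply: congrD|]; apply: congrM;
  rewrite ?modn_mod // bin2_mod9;
  do ?[apply: congrM | apply: congrD]; by rewrite ?modn_mod.
have EE3 : E = form (i %% 9)%N (d %% 9)%N (s %% 9)%N (r %% 9)%N %[mod 3].
  by rewrite -[LHS](@modn_dvdm 9) // EE modn_dvdm.
rewrite EE3 EE => e; rewrite -[RHS]modn_mod.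
rewrite -(@modn_dvdm 9 i 3) // in i3; rewrite -(@modn_dvdm 9 d 3) // in d3.
have check : all (fun i => all (fun d => all (fun s => all (fun r =>
  [&& i %% 3 == 2, d %% 3 == 0 & form i d s r %% 3 == 2]%N
    ==> (form i d s r %% 9 == i %% 9)%N)
  (iota 0 9)) (iota 0 9)) (iota 0 9)) (iota 0 9).
  by rewrite /form /bin2'; case: c {E EE EE3 e} @form; vm_compute.
have mem x : (x %% 9)%N \in iota 0 9 by rewrite mem_iota ltn_mod.
apply/eqP; move: check.
move=> /allP/(_ _ (mem i))/allP/(_ _ (mem d)).
move=> /allP/(_ _ (mem s))/allP/(_ _ (mem r)).
by rewrite e i3 d3.
Qed.

Lemma theta_exp_mod9 i k N N' t s : (i < k)%N ->
  k = 2 %[mod 3] -> i = 2 %[mod 3] ->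
  let E := (theta_exp i k N t + theta_exp 1 2 N' s)%N in
  E = 2 %[mod 3] -> E = i %[mod 9].
Proof.
move=> ltik k3 i3 E.
have d3 : (k - i)%N = 0 %[mod 3] by lia.
have [r rE] : exists r, theta_exp 1 2 N' s = (r ^ 2)%N.
  (* Consecutive triangular numbers add up to a square, so Gauss's exponents are squares. *)
  have sq r : ('C(r.+1, 2) + 'C(r, 2) = r ^ 2)%N.
    elim: r => // r; rewrite binS bin1 => IHr.
    by rewrite binS bin1 binS bin1; lia.
  rewrite /theta_exp !mul1n; have [leNs|ltNs] := leqP N' s.
    exists (s - N')%N; rewrite -sq.
    by have -> : (N' - s = 0)%N; [lia | rewrite !addn0].
  exists (N' - s)%N; rewrite -sq.
  by have -> : (s - N' = 0)%N; [lia | rewrite !add0n addnC].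
rewrite /E rE /theta_exp; have [leNt|ltNt] := leqP N t.
  have -> : (N - t = 0)%N by lia.
  have := @theta_form_mod9 true i (k - i) (t - N) r i3 d3.
  by rewrite /= !addn0 addn1.
have -> : (t - N = 0)%N by lia.
have := @theta_form_mod9 false i (k - i) (N - t) r i3 d3.
by rewrite /= !add0n !addn0 addn1.
Qed.

Lemma S_dvd4 k i n : (1 <= i)%N -> (2 * i <= k)%N ->
  k = 2 %[mod 3] -> i = 2 %[mod 3] -> n = 2 %[mod 3] -> n <> i %[mod 9] ->
  (S_ k i n = 0 %[mod 4])%Z.
Proof.
move=> i0 leik k3 i3 n3 nNi; rewrite mod0z; apply/dvdz_mod0P.
(* Truncating at [n.+1] retains the coefficient at [n]. *)
have /(_ n (ltnSn n)) := @S_mod4 k i n.+1 i0 leik.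
rewrite coefB coef_poly ltnSn coef_theta_sumM ?subr0 // => t s.
apply/eqP=> En; apply: nNi; rewrite -En; apply: theta_exp_mod9; rewrite ?En //.
lia.
Qed.

Theorem mainTheorem2 (k i : nat)
    (hi : (1 <= i)%N) (hik : (2 * i <= k)%N) (hk : k = 2 %[mod 3]) (n : nat) :
  (i = 2 %[mod 9] ->
    (S_ k i (9 * n + 5)%N = 0 %[mod 4])%Z /\
    (S_ k i (9 * n + 8)%N = 0 %[mod 4])%Z) /\
  (i = 5 %[mod 9] ->
    (S_ k i (9 * n + 2)%N = 0 %[mod 4])%Z /\
    (S_ k i (9 * n + 8)%N = 0 %[mod 4])%Z) /\
  (i = 8 %[mod 9] ->
    (S_ k i (9 * n + 2)%N = 0 %[mod 4])%Z /\
    (S_ k i (9 * n + 5)%N = 0 %[mod 4])%Z).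
Proof.
(* The residues 2, 5, 8 mod 9 are those equal to 2 mod 3; each case takes the two that differ from
   [i]. *)
by do !split; apply: S_dvd4 => //; lia.
Qed.
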